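(* Let $G$ be a metabelian group and let $p$ be a prime number. Then the connected diameter of the $p$-local commensurability graph of $G$ is at most $4$.
   Context: For a group $G$ and a prime $p$, the $p$-local commensurability graph $\Gamma_p(G)$ has as vertices all finite-index subgroups of $G$, and an edge is drawn between (distinct) $A$ and $B$ if $[A: A\cap B][B: A\cap B]$ is a power of $p$ (where $1=p^0$ counts as a power of $p$). The connected diameter of a graph is the supremum, over all connected components of the graph, of the graph diameter of the component. *)

(* Defs.v *)
From mathcomp Require Import all_boot all_order all_algebra finmap.
From mathcomp Require Import all_classical all_reals ereal Rstruct.

Set Implicit Arguments.
Unset Strict Implicit.
Unset Printing Implicit Defensive.

Local Open Scope classical_set_scope.
Local Open Scope group_scope.

Local Notation R := Rdefinitions.R.

(* Groups may be infinite: groupType is the structure of monoid.v, and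
   subgroups are arbitrary (not necessarily decidable) subsets. *)
Section Groups.
Variable G : groupType.
Implicit Types A B : set G.

Definition is_subgroup A : Prop := group_closed [in A].

Definition derived_subgroup : set G :=
  smallest is_subgroup [set [~ x, y] | x in setT & y in setT].

Definition metabelian : Prop :=
  {in derived_subgroup &, forall x y, commute x y}.

Definition left_cosets A B : set (set G) := [set [set x * b | b in B] | x in A].

(* The index [A : B] of a subgroup B of A. It is 0 when the index is infinite,
   since fset_set sends infinite sets to fset0. *)
Definition subindex A B : nat := #|` fset_set (left_cosets A B)|.

Record fi_subgroup := FiSubgroup {
  fi_set :> set G;
  fi_subgroupP : is_subgroup fi_set;
  fi_finite : finite_set (left_cosets setT fi_set) }.

Definition local_comm_edge (p : nat) (A B : fi_subgroup) : Prop :=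
  fi_set A <> fi_set B /\
  exists k, (subindex A (A `&` B) * subindex B (A `&` B) = p ^ k)%N.

End Groups.

(* A graph on V is given by its adjacency relation e, assumed symmetric. *)
Section Graphs.
Variables (V : Type) (e : V -> V -> Prop).

Fixpoint walk (n : nat) (u v : V) : Prop :=
  if n is m.+1 then exists2 w, e u w & walk m w v else u = v.

Definition component (u : V) : set V := [set v | exists n, walk n u v].

(* +oo when u and v are in different components, as ereal_inf set0 = +oo. *)
Definition graph_dist (u v : V) : \bar R :=
  ereal_inf [set (n%:R)%:E | n in [set n | walk n u v]].

(* Walks do not leave a component, so the distance in the whole graph between
   two vertices of a component is their distance in that component. *)
Definition diameter (C : set V) : \bar R :=
  ereal_sup [set graph_dist u v | u in C & v in C].

Definition connected_diameter : \bar R :=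
  ereal_sup [set diameter (component u) | u in setT].

End Graphs.

(* Main.v *)
(* In a finite metabelian group R, put P = 'O_p(R'). Two adjacent subgroups A
   and B share the Hall p'-subgroups of A :&: B, and for Hall p'-subgroups H and
   K of the same subgroup the groups HP and KP coincide: K is conjugate to H in
   A, and [H, A] lies in R' :&: A, whose p'-part is normal in A, hence contained
   in H, and whose p-part is contained in P. So HP only depends on the component
   of A, and A, H, HP = KP, K, B is a path joining any two subgroups A and B of
   a component with Hall p'-subgroups H and K.

   For an infinite group G, take the image of the whole component in a finite
   quotient by a normal subgroup contained in the two end points A and B: edges
   map to edges (or loops), and the path of length 4 lifts. *)
Require Import Defs.
From mathcomp Require Import all_boot all_order all_algebra.
From mathcomp Require Import all_classical all_reals ereal Rstruct.
From mathcomp Require Import all_fingroup all_solvable finmap fintype finset.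

Set Implicit Arguments.
Unset Strict Implicit.
Unset Printing Implicit Defensive.

(** * Hall p'-subgroups in finite metabelian groups *)

Section Finite.
Local Open Scope group_scope.
Variables (gT : finGroupType) (p : nat) (G : {group gT}).
Hypothesis abG' : abelian G^`(1).

Lemma solvable_abelian_der1 : solvable G.
Proof.
rewrite (series_sol (der_normal 1 G)) (abelian_sol abG').
by rewrite abelian_sol ?der_abelian.
Qed.

(** The intersection [M] is abelian, hence the product of its p'-core and its p-core. The first is a
    normal p'-subgroup of [A], so it lies in every Hall p'-subgroup; the second is normal in the
    abelian derived subgroup of [G], so it lies in the p-core of that subgroup. *)
Lemma der1_cap_sub_Hall (A H : {group gT}) :
  A \subset G -> p^'.-Hall(A) H -> G^`(1) :&: A \subset H * 'O_p(G^`(1)).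
Proof.
move=> sAG hallH.
pose M := (G^`(1) :&: A)%G.
have abM : abelian M by apply: abelianS abG'; apply: subsetIl.
have nMA : M <| A.
  rewrite /normal subsetIr normsI ?normG //.
  exact: subset_trans sAG (der_norm 1 G).
have [_ defM _ _] := dprodP (nilpotent_pcoreC p^' (abelian_nil abM)).
rewrite -[G^`(1) :&: A]defM; apply: mulgSS.
  apply: subset_trans (pcore_sub_Hall hallH).
  apply: pcore_max; first exact: pcore_pgroup.
  exact: gFnormal_trans.
rewrite (eq_pcore _ (negnK _)).
apply: pcore_max; first exact: pcore_pgroup.
have sMG' : 'O_p(M) \subset G^`(1) := subset_trans (pcore_sub _ _) (subsetIl _ _).
rewrite /normal sMG'; apply: cents_norm.
exact: subset_trans abG' (centS sMG').
Qed.

Lemma Hall_join_pcore_der1 (A H K : {group gT}) :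
  A \subset G -> p^'.-Hall(A) H -> p^'.-Hall(A) K ->
  H <*> 'O_p(G^`(1)) = K <*> 'O_p(G^`(1)).
Proof.
move=> sAG; set P := 'O_p(G^`(1)).
have nPA : A \subset 'N(P) by apply: subset_trans sAG _; rewrite !gFnorm_trans ?normG.
suff sub (L M : {group gT}) : p^'.-Hall(A) L -> p^'.-Hall(A) M -> L \subset M <*> P.
  by move=> hH hK; apply/eqP; rewrite eqEsubset !join_subG !joing_subr !sub.
move=> hallL hallM; have sMA := pHall_sub hallM.
have [a aA /= ->] := Hall_trans (solvableS sAG solvable_abelian_der1) hallL hallM.
rewrite (norm_joinEl (subset_trans sMA nPA)).
apply/subsetP => _ /imsetP[h hM ->].
(* Here [h ^ a = h * [~ h, a]]. Doubling [M] leaves one factor for [h] and the product [M * P] for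
   the commutator. *)
rewrite conjg_mulR -[M : {set _}]mulGid -mulgA mem_mulg //.
apply: (subsetP (der1_cap_sub_Hall sAG hallM)).
have hA := subsetP sMA h hM.
by rewrite inE mem_commg ?(subsetP sAG) //= groupR.
Qed.

Lemma adjacent_join_pcore_der1 (A B H K : {group gT}) :
  A \subset G -> B \subset G ->
  p.-nat #|A : A :&: B| -> p.-nat #|B : A :&: B| ->
  p^'.-Hall(A) H -> p^'.-Hall(B) K ->
  H <*> 'O_p(G^`(1)) = K <*> 'O_p(G^`(1)).
Proof.
move=> sAG sBG pA pB hallH hallK.
have sABG := subset_trans (subsetIl A B) sAG.
have [L hallL] := Hall_exists p^' (solvableS sABG solvable_abelian_der1).
have [sLAB p'L pL] := and3P hallL.
(* Since [#|C : L|] is the product of [#|C : A :&: B|] and [#|A :&: B : L|], both powers of [p], [L]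
   stays a Hall subgroup in [A] and in [B]. *)
suff hall (C : {group gT}) : A :&: B \subset C -> p.-nat #|C : A :&: B| -> p^'.-Hall(C) L.
  rewrite (Hall_join_pcore_der1 sAG hallH (hall _ (subsetIl _ _) pA)).
  exact: Hall_join_pcore_der1 sBG (hall _ (subsetIr _ _) pB) hallK.
move=> sC pC; rewrite /pHall (subset_trans sLAB sC) p'L /=.
by rewrite -(Lagrange_index sC sLAB) pnatM pL andbT (eq_pnat _ (negnK _)).
Qed.

Lemma index_joing_pgroup (H P : {group gT}) :
  H \subset 'N(P) -> p.-group P -> p.-nat #|H <*> P : H|.
Proof.
move=> nPH pP; rewrite norm_joinEl // indexMg.
exact: pnat_dvd (dvdn_indexg P H) pP.
Qed.

End Finite.

(** * Closure properties of subgroups given as sets *)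

Section Subgroups.
Local Open Scope group_scope.
Variable G : groupType.
Implicit Types A : set G.

Lemma subgroupT : is_subgroup [set: G]%classic.
Proof. by split=> // *; rewrite mem_set. Qed.

Lemma subgroup1 A : is_subgroup A -> A 1.
Proof. by case=> /set_mem. Qed.

Lemma subgroup_div A x y : is_subgroup A -> A x -> A y -> A (x * y^-1).
Proof. by case=> _ Ad Ax Ay; apply/set_mem/Ad; apply/mem_set. Qed.

Lemma subgroupV A x : is_subgroup A -> A x -> A x^-1.
Proof. by move=> sA Ax; rewrite -[x^-1]mul1g; apply: subgroup_div (subgroup1 sA) Ax. Qed.

Lemma subgroupM A x y : is_subgroup A -> A x -> A y -> A (x * y).
Proof. by move=> sA Ax Ay; rewrite -[y]invgK; apply: subgroup_div (subgroupV sA Ay). Qed.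

End Subgroups.

(** * Images and preimages under a homomorphism to a finite group *)

Section FiniteImage.
Local Open Scope group_scope.
Variables (G : groupType) (gT : finGroupType) (f : G -> gT).
Hypothesis fM : {morph f : x y / x * y}.
Implicit Types (A B : set G) (X Y : {group gT}).

Let f1 : f 1 = 1.
Proof. by apply: (mulgI (f 1)); rewrite -fM !mulg1. Qed.

Let fV x : f x^-1 = (f x)^-1.
Proof. by apply: (mulgI (f x)); rewrite -fM !mulgV f1. Qed.

Definition fin_image (A : set G) : {set gT} := [set y | `[< (f @` A)%classic y >]].

Lemma fin_imageP A y : reflect (exists2 x, A x & f x = y) (y \in fin_image A).
Proof. by rewrite inE; apply: asboolP. Qed.

Lemma mem_fin_image A x : A x -> f x \in fin_image A.
Proof. by move=> Ax; apply/fin_imageP; exists x. Qed.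

Lemma fin_imageS A B : (A `<=` B)%classic -> fin_image A \subset fin_image B.
Proof. by move=> sAB; apply/subsetP => _ /fin_imageP[x /sAB Bx <-]; apply: mem_fin_image. Qed.

Lemma fin_image_group_set A : is_subgroup A -> group_set (fin_image A).
Proof.
move=> sA; apply/group_setP; split.
  by rewrite -[X in X \in _]f1; apply: mem_fin_image; apply: subgroup1.
move=> _ _ /fin_imageP[x Ax <-] /fin_imageP[y Ay <-].
by rewrite -fM; apply: mem_fin_image; apply: subgroupM.
Qed.

Lemma subgroup_preimage X : is_subgroup (f @^-1` [set` X])%classic.
Proof.
split; first by apply/mem_set; rewrite /= f1 group1.
by move=> x y /set_mem /= Xx /set_mem /= Xy; apply/mem_set; rewrite /= fM fV groupM ?groupV.
Qed.

(** The right-hand side is an explicit finite set, from which both finiteness and the index are read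
    off. As [X] lies in the range of [f], each coset of [Y] in [X] has a representative [f x]. *)
Lemma left_cosets_preimage X Y : Y \subset X -> X \subset fin_image [set: G]%classic ->
  left_cosets (f @^-1` [set` X]) (f @^-1` [set` Y]) =
  [set` [fset (f @^-1` [set` (S : {set gT})])%classic | S in lcosets Y X]%fset]%classic.
Proof.
move=> sYX sXf; apply/seteqP.
have cosetE x : [set x * y | y in f @^-1` [set` Y]]%classic =
                (f @^-1` [set` f x *: Y])%classic.
  apply/seteqP; split=> [_ /= [y Yy <-]|z /=].
    by rewrite fM mem_lcoset mulKg.
  rewrite mem_lcoset => Yz; exists (x^-1 * z); last by rewrite mulKVg.
  by rewrite /= fM fV.
split=> [U [x Xx <-]|U /= /imfsetP[S /= /lcosetsP[y Xy ->] ->]].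
  rewrite cosetE; apply/imfsetP; exists (f x *: Y) => //=.
  by apply/lcosetsP; exists (f x).
have [x _ fx] := fin_imageP _ _ (subsetP sXf y Xy).
by exists x; rewrite /= ?fx // cosetE fx.
Qed.

(** Distinct cosets have distinct preimages because each of them meets the range of [f]. *)
Lemma subindex_preimage X Y : Y \subset X -> X \subset fin_image [set: G]%classic ->
  subindex (f @^-1` [set` X]) (f @^-1` [set` Y]) = #|X : Y|.
Proof.
move=> sYX sXf; rewrite /subindex left_cosets_preimage // set_fsetK.
rewrite card_in_imfset /=; first by rewrite -card_lcosets cardE.
move=> S T /lcosetsP[x Xx ->] /lcosetsP[y Xy ->] eqST.
have [z _ fz] := fin_imageP _ _ (subsetP sXf y Xy).
have : (f @^-1` [set` y *: Y])%classic z by rewrite /= fz lcoset_refl.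
by rewrite -eqST /= fz => /lcoset_eqP.
Qed.

Lemma finite_left_cosets_preimage X : X \subset fin_image [set: G]%classic ->
  finite_set (left_cosets [set: G]%classic (f @^-1` [set` X])).
Proof.
move=> sXf.
have -> : [set: G]%classic = (f @^-1` [set` fin_image [set: G]%classic])%classic.
  by apply/seteqP; split=> // x _; apply: mem_fin_image.
by rewrite (@left_cosets_preimage (Group (fin_image_group_set (subgroupT G))) X).
Qed.

Lemma preimage_fin_image A : is_subgroup A -> (forall x, f x = 1 -> A x) ->
  (f @^-1` [set` fin_image A])%classic = A.
Proof.
move=> sA kerA; apply/seteqP; split=> [x /= /fin_imageP[a Aa fa]|x Ax]; last exact: mem_fin_image.
rewrite -[x](mulgKV a); apply: (subgroupM sA) Aa.
by apply: kerA; rewrite fM fV fa mulgV.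
Qed.

Lemma metabelian_fin_image : metabelian G ->
  abelian (Group (fin_image_group_set (subgroupT G)))^`(1).
Proof.
(* It suffices that the generating commutators commute, and these are images of commutators of
   [G]. *)
move=> mG; rewrite abelian_gen; apply/centsP.
move=> _ /imset2P[_ _ /fin_imageP[a _ <-] /fin_imageP[b _ <-] ->].
move=> _ /imset2P[_ _ /fin_imageP[c _ <-] /fin_imageP[d _ <-] ->].
have fR x y : [~ f x, f y] = f [~ x, y] by rewrite !commgEl !conjgE !(fM, fV).
have comm x y : [~ x, y] \in @derived_subgroup G.
  by apply/mem_set; apply: sub_gen_smallest; exists x => //; exists y.
by rewrite /commute !fR -!fM mG.
Qed.

End FiniteImage.

(** * Passing edges and walks to finite quotients and back *)

Section Transfer.
Local Open Scope group_scope.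
Variable G : groupType.
Implicit Types A B C : fi_subgroup G.

(** Edges compare underlying sets, while a walk of length 0 is an equality of records. *)
Lemma fi_subgroup_inj A B : fi_set A = fi_set B -> A = B.
Proof.
by case: A B => [A sA fA] [B sB fB] /= eqAB; subst B; congr FiSubgroup; apply: Prop_irrelevance.
Qed.

(* G acts by left translations on the finite set of left cosets of A. *)
Lemma fi_subgroup_representation A : exists (gT : finGroupType) (f : G -> gT),
  {morph f : x y / x * y} /\ forall x, f x = 1 -> fi_set A x.
Proof.
have sA := fi_subgroupP A.
pose trans g (S : set G) := [set g * s | s in S]%classic.
have transM g h S : trans (g * h) S = trans g (trans h S).
  by rewrite /trans image_comp; apply: eq_imagel => x _ /=; rewrite mulgA.
have trans1 S : trans 1 S = S.
  by rewrite /trans -[RHS]image_id; apply: eq_imagel => x _ /=; rewrite mul1g.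
have [X defX] := finite_fsetP.1 (fi_finite A).
have memX T : T \in X <-> left_cosets [set: G]%classic A T by rewrite defX.
have transX g S : S \in X -> trans g S \in X.
  by rewrite !memX => -[h _ <-]; exists (g * h) => //; apply: transM.
(* Permutations compose from left to right, so translating by [g^-1] gives a morphism in [g]. *)
have injX g : injective (fun S : X => FSetSub (transX g^-1 (val S) (valP S))).
  move=> S T /(congr1 val) /= eqST; apply: val_inj.
  by rewrite -[val S]trans1 -[val T]trans1 -(mulgV g) !transM eqST.
exists {perm X}, (fun g => perm (injX g)); split=> [g h|x /permP px].
  by apply/permP=> S; apply: val_inj; rewrite permM !permE /= invgM transM.
have AX : fi_set A \in X by apply/memX; exists 1 => //; apply: trans1.
have := congr1 val (px (FSetSub AX)); rewrite !permE /= => eqA.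
rewrite -[x]invgK; apply: subgroupV => //; rewrite -eqA.
by exists 1; [apply: subgroup1 | rewrite mulg1].
Qed.

Lemma fi_subgroup_representation2 A B : exists (gT : finGroupType) (f : G -> gT),
  [/\ {morph f : x y / x * y}, forall x, f x = 1 -> fi_set A x
    & forall x, f x = 1 -> fi_set B x].
Proof.
have [gA [fA [fAM kerA]]] := fi_subgroup_representation A.
have [gB [fB [fBM kerB]]] := fi_subgroup_representation B.
exists (gA * gB)%type, (fun x => (fA x, fB x)); split=> [x y|x [fx _]|x [_ fx]].
- by rewrite fAM fBM.
- exact: kerA.
- exact: kerB.
Qed.

Section Image.
Variables (gT : finGroupType) (f : G -> gT).
Hypothesis fM : {morph f : x y / x * y}.

Definition image_group A : {group gT} := Group (fin_image_group_set fM (fi_subgroupP A)).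

Definition range_group : {group gT} := Group (fin_image_group_set fM (subgroupT G)).

Lemma image_group_sub A : image_group A \subset range_group.
Proof. exact: fin_imageS. Qed.

Definition preimage_fi (X : {group gT}) (sX : X \subset range_group) : fi_subgroup G :=
  FiSubgroup (subgroup_preimage fM X) (finite_left_cosets_preimage fM sX).

End Image.

Lemma subindex_preimageI (gT : finGroupType) (f : G -> gT) (fM : {morph f : x y / x * y})
    (X Y : {group gT}) : X \subset range_group fM ->
  subindex (f @^-1` [set` X]) ((f @^-1` [set` X]) `&` (f @^-1` [set` Y])) = #|X : X :&: Y|.
Proof.
move=> sX; rewrite -(subindex_preimage fM) ?subsetIl //; congr subindex.
by apply/seteqP; split=> x /=; rewrite !inE => /andP.
Qed.

Lemma edge_image (p : nat) A B (gT : finGroupType) (f : G -> gT) (fM : {morph f : x y / x * y}) :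
  prime p -> local_comm_edge p A B ->
  p.-nat #|image_group fM A : image_group fM A :&: image_group fM B| &&
  p.-nat #|image_group fM B : image_group fM A :&: image_group fM B|.
Proof.
move=> p_pr [_ [k eqk]].
have [hT [h [hM kerA kerB]]] := fi_subgroup_representation2 A B.
(* The kernel of f need not lie in A and B, so the indices are computed in a
   finer quotient and then projected. *)
pose fh x := (f x, h x).
have fhM : {morph fh : x y / x * y} by move=> x y; rewrite /fh fM hM.
set A' := image_group fhM A; set B' := image_group fhM B.
have defA : (fh @^-1` [set` A'])%classic = A.
  by apply: preimage_fin_image (fi_subgroupP A) _ => // x [_ /kerA].
have defB : (fh @^-1` [set` B'])%classic = B.
  by apply: preimage_fin_image (fi_subgroupP B) _ => // x [_ /kerB].
have eqA := subindex_preimageI B' (image_group_sub fhM A).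
have eqB := subindex_preimageI A' (image_group_sub fhM B).
rewrite -/A' -/B' !(defA, defB) in eqA eqB.
have : p.-nat (p ^ k)%N by rewrite pnatX pnat_id.
rewrite -eqk eqA [(fi_set A `&` fi_set B)%classic]classical_sets.setIC eqB finset.setIC.
rewrite pnatM setIC => /andP[pA pB].
pose fstm := @fst_morphism gT hT.
have img C : fstm @* image_group fhM C = image_group fM C.
  rewrite morphimEsub ?subsetT //; apply/setP=> y.
  apply/imsetP/idP => [[z /fin_imageP[x Cx <-] ->]|/fin_imageP[x Cx <-]].
    exact: mem_fin_image.
  by exists (fh x) => //; apply: mem_fin_image.
(* The image of an intersection can be smaller than the intersection of the images; the index of the
   larger subgroup still divides that of the smaller. *)
have sAB : fstm @* (A' :&: B') \subset image_group fM A :&: image_group fM B.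
  by rewrite -!img subsetI !morphimS ?subsetIl ?subsetIr.
have pimg C : p.-nat #|image_group fhM C : A' :&: B'| ->
    p.-nat #|image_group fM C : image_group fM A :&: image_group fM B|.
  apply: pnat_dvd; rewrite -[in X in X %| _]img; apply: dvdn_trans (indexgS _ sAB) _.
  by rewrite index_morphim ?subsetT.
by rewrite !pimg.
Qed.

(* Adjacent or equal. *)
Definition quasi_edge (p : nat) A B :=
  exists k, (subindex A (A `&` B) * subindex B (A `&` B) = p ^ k)%N.

Lemma quasi_edge_sym (p : nat) A B : quasi_edge p A B -> quasi_edge p B A.
Proof.
by move=> [k eqk]; exists k; rewrite [(fi_set B `&` fi_set A)%classic]classical_sets.setIC mulnC.
Qed.

(** If [A] and [B] coincide no step is added, so the new length is only bounded. *)
Lemma quasi_edge_walk (p n : nat) A B C :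
  quasi_edge p A B -> walk (@local_comm_edge G p) n B C ->
  exists2 m, (m <= n.+1)%N & walk (@local_comm_edge G p) m A C.
Proof.
move=> qAB wBC; have [/fi_subgroup_inj -> | neqAB] := pselect (fi_set A = fi_set B).
  by exists n.
by exists n.+1 => //; exists B.
Qed.

(** * The invariant of a component, and the edges of the lifted path *)

Section Walks.
Variables (p : nat) (gT : finGroupType) (f : G -> gT) (fM : {morph f : x y / x * y}).
Hypothesis (mG : metabelian G) (p_pr : prime p).
Let N := (range_group fM)^`(1).

Let abN : abelian N.
Proof. exact: metabelian_fin_image. Qed.

Lemma walk_Hall_join_pcore (n : nat) A B (H K : {group gT}) :
  walk (@local_comm_edge G p) n A B ->
  p^'.-Hall(image_group fM A) H -> p^'.-Hall(image_group fM B) K ->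
  H <*> 'O_p(N) = K <*> 'O_p(N).
Proof.
have sub C := image_group_sub fM C.
elim: n A H => [|n IHn] A H /=.
  by move=> <- hallH hallK; apply: (Hall_join_pcore_der1 abN (sub A) hallH).
move=> [C eAC wCB] hallH hallK.
have solC : solvable (image_group fM C) := solvableS (sub C) (solvable_abelian_der1 abN).
have [L hallL] := Hall_exists p^' solC.
have [pA pC] := andP (edge_image fM p_pr eAC).
rewrite (adjacent_join_pcore_der1 abN (sub A) (sub C) pA pC hallH hallL).
exact: IHn wCB hallL hallK.
Qed.

Lemma preimage_quasi_edge (X Y : {group gT})
    (sX : X \subset range_group fM) (sY : Y \subset range_group fM) :
  X \subset Y -> p.-nat #|Y : X| -> quasi_edge p (preimage_fi sX) (preimage_fi sY).
Proof.
move=> sXY /p_natP[k eqk]; exists k; rewrite /= subindex_preimageI //.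
rewrite [X in subindex _ X]classical_sets.setIC subindex_preimageI //.
by rewrite (setIidPl sXY) (setIidPr sXY) indexgg mul1n.
Qed.

(** By the kernel condition [A] is the preimage of its image, in which [H] has p-power index. *)
Lemma Hall_quasi_edge A (H : {group gT}) (sH : H \subset range_group fM) :
  (forall x, f x = 1 -> fi_set A x) -> p^'.-Hall(image_group fM A) H ->
  quasi_edge p (preimage_fi sH) A.
Proof.
move=> kerA /and3P[sHA _ pH].
have <- : preimage_fi (image_group_sub fM A) = A.
  exact/fi_subgroup_inj/preimage_fin_image/kerA/fi_subgroupP.
by apply: preimage_quasi_edge; rewrite // -(eq_pnat _ (negnK _)).
Qed.

End Walks.

(** Both walks start at the base point [C] of the component, so the invariants of [A] and [B] are
    each compared with that of [C]. *)
Lemma metabelian_walk_le4 (p n m : nat) A B C :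
  metabelian G -> prime p ->
  walk (@local_comm_edge G p) n C A -> walk (@local_comm_edge G p) m C B ->
  exists2 l, (l <= 4)%N & walk (@local_comm_edge G p) l A B.
Proof.
move=> mG p_pr wCA wCB.
have [gT [f [fM kerA kerB]]] := fi_subgroup_representation2 A B.
have sub D := image_group_sub fM D.
have solR := solvable_abelian_der1 (metabelian_fin_image fM mG).
have hallE D := Hall_exists p^' (solvableS (sub D) solR).
have [[H hallH] [K hallK] [L hallL]] := And3 (hallE A) (hallE B) (hallE C).
pose P := 'O_p((range_group fM)^`(1))%G.
have eqHK : H <*> P = K <*> P.
  have eqL := walk_Hall_join_pcore mG p_pr.
  have eqLH := eqL _ _ _ _ _ _ _ _ wCA hallL hallH.
  exact: etrans (esym eqLH) (eqL _ _ _ _ _ _ _ _ wCB hallL hallK).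
have sHR := subset_trans (pHall_sub hallH) (sub A).
have sKR := subset_trans (pHall_sub hallK) (sub B).
have nPR : range_group fM \subset 'N(P) by rewrite !gFnorm_trans ?normG.
have sFR : H <*> P \subset range_group fM by rewrite join_subG sHR !gFsub_trans.
have edgeF (M : {group gT}) (sM : M \subset range_group fM) : M <*> P = H <*> P ->
    quasi_edge p (preimage_fi sM) (preimage_fi sFR).
  move=> eqM; apply: preimage_quasi_edge; rewrite /= -eqM ?joing_subl //.
  by rewrite index_joing_pgroup ?pcore_pgroup // (subset_trans sM).
have eAH := quasi_edge_sym (Hall_quasi_edge sHR kerA hallH).
have eFK := quasi_edge_sym (edgeF K sKR (esym eqHK)).
(* The path is built backwards from [B]: the preimages of [K], [K <*> P = H <*> P] and [H], then
   [A], are put in front in turn. Each adds at most 1 to the length, hence the bound 4. *)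
have [a lea wa] := quasi_edge_walk (Hall_quasi_edge sKR kerB hallK) (erefl : walk _ 0 B B).
have [b leb wb] := quasi_edge_walk eFK wa.
have [c lec wc] := quasi_edge_walk (edgeF H sHR erefl) wb.
have [d led wd] := quasi_edge_walk eAH wc.
exists d => //.
by rewrite (leq_trans led) // ltnS (leq_trans lec) // ltnS (leq_trans leb).
Qed.

End Transfer.

Theorem theorem1 (G : groupType) (p : nat) :
  metabelian G -> prime p ->
  (connected_diameter (@local_comm_edge G p) <= 4%:R%:E)%E.
Proof.
move=> mG p_pr; apply: ge_ereal_sup => _ [C _ <-].
apply: ge_ereal_sup => _ [A [n wCA] [B [m wCB] <-]].
have [l le_l4 wAB] := metabelian_walk_le4 mG p_pr wCA wCB.
apply: ereal_inf_le; exists (l%:R)%:E; first by exists l.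
by rewrite lee_fin Num.Theory.ler_nat.
Qed.
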